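(* Let $x^{+}=f(x,u)$, $\dim(x)=n$, $\dim(u)=m$, be a flat discrete-time system with flat output $y=\varphi(\zeta_{[-q_1]},\dots,\zeta_{[-1]},x,u,\dots,u_{[q_2]})$ and parameterization $x=F_x(y_{[0,R-1]})$, $u=F_u(y_{[0,R]})$. Let $A=(a^1,\dots,a^m)$ be a multi-index with $0\le A\leq R$ such that, with $\underline a=\min_j a^j$, the differentials $$\mathrm{d}\zeta_{[-q_{1}+\underline a]},\ldots,\mathrm{d}\zeta_{[-1]},\ \mathrm{d}x,\ \mathrm{d}\delta^{A}(\varphi),\ldots,\mathrm{d}\delta^{R-1}(\varphi)$$ are linearly independent. Let $\varphi_c$, $\Psi$ and $\psi_{c,[1]}$ be as defined in the context. Then with the feedback $$z^{+}=\psi_{c,[1]}(x,z,v_{[0,R-A]}),\qquad u=F_{u}\circ\Psi(x,z,v_{[0,R-A]}),\qquad \dim(z)=\#A-n,$$ the closed-loop system $$x^{+}=f\bigl(x,F_{u}\circ\Psi(x,z,v_{[0,R-A]})\bigr),\qquad z^{+}=\psi_{c,[1]}(x,z,v_{[0,R-A]})$$ has the input-output behaviour $y_{[A]}=v$, i.e. $y^j_{[a^j]}=v^j$ for $j=1,\dots,m$.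
   Context: System. All functions are smooth and all considerations are local, in a suitable neighborhood of an equilibrium $(x_0,u_0)$, $x_0=f(x_0,u_0)$. The system is $x^{i,+}=f^i(x,u)$, $i=1,\dots,n$, $u=(u^1,\dots,u^m)$, with $\mathrm{rank}(\partial_{(x,u)}f)=n$. Fix $m$ functions $g(x,u)$ such that $(x,u)\mapsto(x^+,\zeta)=(f(x,u),g(x,u))$ is locally invertible. Shifts. Trajectories on a finite time interval are identified with points of a manifold with coordinates $(\zeta_{[-l_\zeta]},\dots,\zeta_{[-1]},x,u,u_{[1]},\dots,u_{[l_u]})$, where $\zeta_{[-\beta]}$ stands for $\zeta(k-\beta)$, $u_{[\alpha]}$ for $u(k+\alpha)$, and $l_\zeta,l_u$ are sufficiently large. The forward-shift operator is $$\delta(h(\dots,\zeta_{[-2]},\zeta_{[-1]},x,u,u_{[1]},\dots))=h(\dots,\zeta_{[-1]},g(x,u),f(x,u),u_{[1]},u_{[2]},\dots).$$ Flatness. The system is flat around $(x_0,u_0)$ if $x$ and $u$ can be expressed locally by an $m$-tuple of functions $y^j=\varphi^j(\zeta_{[-q_1]},\dots,\zeta_{[-1]},x,u,\dots,u_{[q_2]})$ (a flat output) and their forward-shifts $y_{[\alpha]}=\delta^\alpha(\varphi)$ up to some finite order. The representation is unique and has the form $x=F_x(y_{[0,R-1]})$, $u=F_u(y_{[0,R]})$, where the multi-index $R=(r^1,\dots,r^m)$ consists of the numbers of forward-shifts of each component of the flat output needed to express $x$ and $u$. Multi-indices. For $A=(a^1,\dots,a^m)$, $B=(b^1,\dots,b^m)$: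 $A\le B$ and $A\pm B$ are componentwise; $A\pm c=(a^1\pm c,\dots,a^m\pm c)$; $\#A=\sum_j a^j$; $y_{[A]}=(y^1_{[a^1]},\dots,y^m_{[a^m]})$; $y_{[A,B]}$ collects all $y^j_{[\alpha]}$ with $a^j\le\alpha\le b^j$ (empty for $j$ if $a^j>b^j$); similarly for $\varphi_{[\alpha]}=\delta^\alpha(\varphi)$ and $v$. A subscript $0$ in $[0,B]$ means all lower indices are $0$. In the list of differentials, $\mathrm{d}\delta^{A}(\varphi),\ldots,\mathrm{d}\delta^{R-1}(\varphi)$ means all $\mathrm{d}\delta^\alpha(\varphi^j)$ with $a^j\le\alpha\le r^j-1$, and the $\zeta$-part is empty if $-q_1+\underline a>-1$. Spans are over the ring of smooth functions. The objects $\varphi_c$, $\Psi$, $\psi_{c,[1]}$. Because of the assumed linear independence and $\mathrm{d}x\in\mathrm{span}\{\mathrm{d}\varphi_{[0,R-1]}\}$, there exists a selection $\varphi_c$ of $\#A-n$ functions from the set $\varphi_{[0,A-1]}$ such that $$\mathrm{span}\{\mathrm{d}\varphi_{[0,R]}\}=\mathrm{span}\{\mathrm{d}x,\mathrm{d}\varphi_{c},\mathrm{d}\varphi_{[A,R]}\}.$$ Consequently there is a (local) diffeomorphism $\Psi:\mathbb{R}^{\#R+m}\to\mathbb{R}^{\#R+m}$ such that locally $\varphi_{[0,R]}=\Psi(x,\varphi_c,\varphi_{[A,R]})$ holds identically; its inverse is $x=F_x(\varphi_{[0,R-1]})$, $\varphi_c=\varphi_c$, $\varphi_{[A,R]}=\varphi_{[A,R]}$.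 Since $\varphi_c\subset\varphi_{[0,A-1]}$, the forward-shifts $\varphi_{c,[1]}=\delta(\varphi_c)$ belong to $\varphi_{[1,A]}\subset\varphi_{[0,R]}$; the corresponding components of $\Psi$ are denoted $\varphi_{c,[1]}=\psi_{c,[1]}(x,\varphi_c,\varphi_{[A,R]})$. Closed loop. $v=(v^1,\dots,v^m)$ is the new input and $v_{[0,R-A]}$ collects $v^j_{[0]},\dots,v^j_{[r^j-a^j]}$, where $v_{[\alpha]}$ stands for $v(k+\alpha)$. The controller state $z$ represents $\varphi_c$ and $v_{[0,R-A]}$ represents $\varphi_{[A,R]}$, so in terms of the closed-loop variables the flat output is given by the corresponding components of $y_{[0,R]}=\Psi(x,z,v_{[0,R-A]})$. The input-output behaviour $y_{[A]}=v$ means that along closed-loop trajectories $y^j(k+a^j)=v^j(k)$, $j=1,\dots,m$. *)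

(* Defs.v *)
From HB Require Import structures.
From mathcomp Require Import all_boot all_order all_algebra.
From mathcomp Require Import all_classical all_reals all_analysis.

Set Implicit Arguments.
Unset Strict Implicit.
Unset Printing Implicit Defensive.

Import Order.TTheory GRing.Theory Num.Theory.
Import numFieldNormedType.Exports.

Local Open Scope classical_set_scope.
Local Open Scope ring_scope.

(* C^infinity near p: on one neighbourhood of p all iterated directional
   derivatives exist and are differentiable (V is always finite-dimensional
   below). *)
Definition smooth_at (R : realType) (V W : normedModType R) (h : V -> W)
    (p : V) : Prop :=
  \forall q \near p, forall s : seq V,
    differentiable (foldr (fun v k => 'D_v k) h s) q.

Definition local_diffeo (R : realType) (V W : normedModType R) (h : V -> W)
    (p : V) : Prop :=
  smooth_at h p /\
  exists k : W -> V,
    [/\ smooth_at k (h p),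
        (\forall q \near p, k (h q) = q) &
        (\forall r \near h p, h (k r) = r)].

(* The transpose of the Jacobian matrix of f with respect to (x, u). *)
Definition jac_xu (R : realType) n m (f : 'rV[R]_n * 'rV[R]_m -> 'rV[R]_n)
    (w : 'rV[R]_n * 'rV[R]_m) : 'M[R]_(n + m, n) :=
  col_mx ('J (fun x => f (x, w.2)) w.1) ('J (fun u => f (w.1, u)) w.2).

(* [midx A B] consists of the pairs (j, alpha) with A j <= alpha < B j, the
   offset alpha - A j being stored.  The upper bound is excluded, so that
   y_[0,R-1] is a vector over midx 0 R also when some r^j = 0, and y_[A,R] is
   one over midx A (R+1). *)
Definition midx m (A B : 'I_m -> nat) : Type := {j : 'I_m & 'I_(B j - A j)}.

HB.instance Definition _ m (A B : 'I_m -> nat) := Finite.on (midx A B).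

Definition mcomp m (A B : 'I_m -> nat) (s : midx A B) : 'I_m := tag s.

Definition mord m (A B : 'I_m -> nat) (s : midx A B) : nat :=
  (A (mcomp s) + tagged s)%N.

Notation mvec R A B := 'rV[R]_#|{: midx A B}|.

Definition mix0 {m} : 'I_m -> nat := fun=> 0%N.
Definition msucc m (A : 'I_m -> nat) : 'I_m -> nat := fun j => (A j).+1.
Definition mle m (A B : 'I_m -> nat) : Prop := forall j, (A j <= B j)%N.
Definition mcard m (A : 'I_m -> nat) : nat := (\sum_j A j)%N.
(* the initial value of the minimum is irrelevant for m > 0 *)
Definition mmin m (A : 'I_m -> nat) : nat :=
  \big[minn/(\max_j A j)%N]_j A j.

Definition mpack (R : realType) m (A B : 'I_m -> nat)
    (y : 'I_m -> nat -> R) : mvec R A B :=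
  \row_k (y (mcomp (enum_val k : midx A B)) (mord (enum_val k : midx A B))).

(* the component y^j_[alpha], 0 if (j, alpha) is out of range *)
Definition mget (R : realType) m (A B : 'I_m -> nat) (y : mvec R A B)
    (j : 'I_m) (alpha : nat) : R :=
  \sum_(k | (mcomp (enum_val k : midx A B) == j) &&
            (mord (enum_val k : midx A B) == alpha)) y 0 k.

Definition mrestr (R : realType) m (A B A' B' : 'I_m -> nat)
    (y : mvec R A B) : mvec R A' B' := mpack A' B' (mget y).

(* A trajectory is given by the coordinates ..., zeta_[-2], zeta_[-1], x, u,
   u_[1], ...  Instead of fixing large l_zeta and l_u, all of them are kept,
   and functions may depend on finitely many only. *)
Inductive coord (n m : nat) : Type :=
  | Zeta of nat & 'I_m  (* Zeta b j is the j-th component of zeta_[-(b+1)] *)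
  | X of 'I_n
  | U of nat & 'I_m.    (* U a j is the j-th component of u_[a] *)
Arguments Zeta {n m}.
Arguments X {n m}.
Arguments U {n m}.

Notation traj R n m := (coord n m -> R).

Section Trajectories.
Variables (R : realType) (n m : nat).
Implicit Types p : traj R n m.

(* the coordinates zeta_[-q1], ..., zeta_[-1], x, u, ..., u_[q2] *)
Notation wspace q1 q2 := ('M[R]_(q1, m) * 'rV[R]_n * 'M[R]_(q2.+1, m))%type.

Definition window q1 q2 p : wspace q1 q2 :=
  (\matrix_(b < q1, j < m) p (Zeta b j), \row_i p (X i),
   \matrix_(a < q2.+1, j < m) p (U a j)).

Definition x_of p : 'rV[R]_n := \row_i p (X i).
Definition u_of p : 'rV[R]_m := \row_j p (U 0 j).

Variables (f : 'rV[R]_n * 'rV[R]_m -> 'rV[R]_n)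
          (g : 'rV[R]_n * 'rV[R]_m -> 'rV[R]_m).

Definition equilibrium_traj (x0 : 'rV[R]_n) (u0 : 'rV[R]_m) : traj R n m :=
  fun c => match c with
    | Zeta _ j => g (x0, u0) 0 j
    | X i => x0 0 i
    | U _ j => u0 0 j
    end.

Definition traj_shift p : traj R n m :=
  fun c => match c with
    | Zeta 0%N j => g (x_of p, u_of p) 0 j
    | Zeta b.+1 j => p (Zeta b j)
    | X i => f (x_of p, u_of p) 0 i
    | U a j => p (U a.+1 j)
    end.

Definition delta (h : traj R n m -> R) : traj R n m -> R := h \o traj_shift.

(* "locally around p0".  For properties that depend on finitely many
   coordinates it is immaterial that all coordinates are constrained. *)
Definition tnear (p0 : traj R n m) (P : traj R n m -> Prop) : Prop :=
  exists e : R, 0 < e /\ forall p, (forall c, `|p c - p0 c| < e) -> P p.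

Definition tsmooth (p0 : traj R n m) (h : traj R n m -> R) : Prop :=
  exists q1 q2 (k : wspace q1 q2 -> R^o),
    smooth_at k (window q1 q2 p0) /\
    tnear p0 (fun p => h p = k (window q1 q2 p)).

(* the differential dh at p, as the family of the partial derivatives of h *)
Definition tdiff (h : traj R n m -> R) p : coord n m -> R :=
  fun c =>
    derive1 (fun t : R =>
      h (fun c' => p c' + (if `[< c' = c >] then t else 0)) : R^o) 0.

Definition diff_independent (p0 : traj R n m) (K : finType)
    (h : K -> traj R n m -> R) : Prop :=
  tnear p0 (fun p => forall lam : K -> R,
    (forall c, \sum_k lam k * tdiff (h k) p c = 0) -> forall k, lam k = 0).

Definition in_diff_span (p0 : traj R n m) (K : finType)
    (h : K -> traj R n m -> R) (h0 : traj R n m -> R) : Prop :=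
  exists lam : K -> traj R n m -> R,
    (forall k, tsmooth p0 (lam k)) /\
    tnear p0 (fun p =>
      forall c, tdiff h0 p c = \sum_k lam k p * tdiff (h k) p c).

Definition same_diff_span (p0 : traj R n m) (K K' : finType)
    (h : K -> traj R n m -> R) (h' : K' -> traj R n m -> R) : Prop :=
  (forall k, in_diff_span p0 h' (h k)) /\
  (forall k, in_diff_span p0 h (h' k)).

Definition is_system (x0 : 'rV[R]_n) (u0 : 'rV[R]_m) : Prop :=
  [/\ smooth_at f (x0, u0),
      f (x0, u0) = x0,
      (\forall w \near (x0, u0), \rank (jac_xu f w) = n) &
      local_diffeo (fun w => (f w, g w)) (x0, u0)].

Variables (q1 q2 : nat) (phi : wspace q1 q2 -> 'rV[R]_m).

(* phi^j_[alpha] = delta^alpha (phi^j) *)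
Definition phis (j : 'I_m) (alpha : nat) : traj R n m -> R :=
  iter alpha delta (fun p => phi (window q1 q2 p) 0 j).

Definition phivec (A B : 'I_m -> nat) p : mvec R A B :=
  mpack A B (fun j alpha => phis j alpha p).

(* s = G(phi_[0,B-1]) locally around p0 *)
Definition expresses (p0 : traj R n m) (B : 'I_m -> nat) k
    (s : traj R n m -> 'rV[R]_k) (G : mvec R mix0 B -> 'rV[R]_k) : Prop :=
  smooth_at G (phivec mix0 B p0) /\
  tnear p0 (fun p => s p = G (phivec mix0 B p)).

(* The last clause says that the representation is unique and that r^j is the
   number of forward-shifts of y^j needed: whenever x and u are expressed by
   y_[0,S], one has R <= S and the expressions coincide with Fx and Fu. *)
Definition flat_output (p0 : traj R n m) (r : 'I_m -> nat)
    (Fx : mvec R mix0 r -> 'rV[R]_n)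
    (Fu : mvec R mix0 (msucc r) -> 'rV[R]_m) : Prop :=
  [/\ smooth_at phi (window q1 q2 p0),
      expresses p0 x_of Fx,
      expresses p0 u_of Fu &
      forall (S : 'I_m -> nat)
        (Gx : mvec R mix0 (msucc S) -> 'rV[R]_n)
        (Gu : mvec R mix0 (msucc S) -> 'rV[R]_m),
        expresses p0 x_of Gx -> expresses p0 u_of Gu ->
        mle r S /\
        \forall y \near phivec mix0 (msucc S) p0,
          Gx y = Fx (mrestr _ _ y) /\ Gu y = Fu (mrestr _ _ y)].

(* The functions whose differentials are dzeta_[-q1+min A], ..., dzeta_[-1],
   dx, ddelta^A(phi), ..., ddelta^(R-1)(phi); the truncated subtraction makes
   the zeta-part empty if min A >= q1. *)
Definition indep_family (A r : 'I_m -> nat)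
    (k : ('I_(q1 - mmin A) * 'I_m) + ('I_n + midx A r)) : traj R n m -> R :=
  match k with
  | inl (b, j) => fun p => p (Zeta b j)
  | inr (inl i) => fun p => p (X i)
  | inr (inr s) => phis (mcomp s) (mord s)
  end.

(* phi_c is the selection of the functions phi^j_[alpha] with
   (j, alpha) = c i for some i. *)
Definition phi_c (A : 'I_m -> nat) nc (c : 'I_nc -> midx mix0 A) p
    : 'rV[R]_nc :=
  \row_i phis (mcomp (c i)) (mord (c i)) p.

Definition full_family (r : 'I_m -> nat) (s : midx mix0 (msucc r))
    : traj R n m -> R :=
  phis (mcomp s) (mord s).

Definition selected_family (A r : 'I_m -> nat) nc
    (c : 'I_nc -> midx mix0 A)
    (k : 'I_n + ('I_nc + midx A (msucc r))) : traj R n m -> R :=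
  match k with
  | inl i => fun p => p (X i)
  | inr (inl i) => phis (mcomp (c i)) (mord (c i))
  | inr (inr s) => phis (mcomp s) (mord s)
  end.

Definition is_selection (p0 : traj R n m) (A r : 'I_m -> nat) nc
    (c : 'I_nc -> midx mix0 A) : Prop :=
  [/\ mcard A = (n + nc)%N,
      injective c &
      same_diff_span p0 (@full_family r) (@selected_family A r nc c)].

Notation cspace A r nc := ('rV[R]_n * 'rV[R]_nc * mvec R A (msucc r))%type.

Definition cl_point (A r : 'I_m -> nat) nc (c : 'I_nc -> midx mix0 A) p
    : cspace A r nc :=
  (x_of p, phi_c c p, phivec A (msucc r) p).

Definition is_Psi (p0 : traj R n m) (A r : 'I_m -> nat) nc
    (c : 'I_nc -> midx mix0 A)
    (Psi : cspace A r nc -> mvec R mix0 (msucc r)) : Prop :=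
  local_diffeo Psi (cl_point r c p0) /\
  tnear p0 (fun p =>
    phivec mix0 (msucc r) p = Psi (cl_point r c p)).

End Trajectories.

Notation cspace R n A r nc := ('rV[R]_n * 'rV[R]_nc * mvec R A (msucc r))%type.

Section ClosedLoop.
Variables (R : realType) (n m : nat) (A r : 'I_m -> nat) (nc : nat).
Variable c : 'I_nc -> midx mix0 A.
Variable Psi : cspace R n A r nc -> mvec R mix0 (msucc r).

(* the components of Psi that correspond to phi_{c,[1]} = delta(phi_c) *)
Definition psi_c1 (w : cspace R n A r nc) : 'rV[R]_nc :=
  \row_i mget (Psi w) (mcomp (c i)) (mord (c i)).+1.

(* v_[0,R-A] at time k, in the position of phi_[A,R]: the entry with index
   (j, alpha) is v^j (k + (alpha - a^j)). *)
Definition vjet (v : nat -> 'rV[R]_m) (k : nat) : mvec R A (msucc r) :=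
  mpack A (msucc r) (fun j alpha => v (k + (alpha - A j))%N 0 j).

Definition cl_state (x : nat -> 'rV[R]_n) (z : nat -> 'rV[R]_nc)
    (v : nat -> 'rV[R]_m) (k : nat) : cspace R n A r nc :=
  (x k, z k, vjet v k).

(* (x, z, v) is a trajectory of the closed loop on the time interval [0, N]
   that stays in D. *)
Definition closed_loop_traj (f : 'rV[R]_n * 'rV[R]_m -> 'rV[R]_n)
    (Fu : mvec R mix0 (msucc r) -> 'rV[R]_m)
    (D : set (cspace R n A r nc)) (N : nat)
    (x : nat -> 'rV[R]_n) (z : nat -> 'rV[R]_nc) (v : nat -> 'rV[R]_m)
    : Prop :=
  (forall k, (k <= N)%N -> D (cl_state x z v k)) /\
  (forall k, (k < N)%N ->
     x k.+1 = f (x k, (Fu \o Psi) (cl_state x z v k)) /\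
     z k.+1 = psi_c1 (cl_state x z v k)).

(* the flat output y(k), the components of order 0 of Psi(x, z, v_[0,R-A]) *)
Definition cl_output (x : nat -> 'rV[R]_n) (z : nat -> 'rV[R]_nc)
    (v : nat -> 'rV[R]_m) (k : nat) : 'rV[R]_m :=
  \row_j mget (Psi (cl_state x z v k)) j 0.

End ClosedLoop.

(* Main.v *)
From HB Require Import structures.
Require Import Defs.
From mathcomp Require Import all_boot all_order all_algebra.
From mathcomp Require Import all_classical all_reals all_analysis.
Import Order.TTheory GRing.Theory Num.Theory.
Import numFieldNormedType.Exports.
Local Open Scope classical_set_scope.
Local Open Scope ring_scope.

(** Along a trajectory of the open-loop system the functions
    w = (x, phi_c, phi_[A,R]) and phi_[0,R] satisfy phi_[0,R] = Psi(w), and the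
    value of w one step later is cl_step (w, phi_[R+1]), where cl_step is the
    right-hand side of the closed loop, extended by the shift of the jet of v
    with phi_[R+1] as the newly entering top entries.  Consequently two
    identities hold on all points (w, v+) of the form
    (cl_point p, next_phi p), with p a trajectory near the equilibrium:

      Psi(cl_step(w, v+))_(j,alpha) = Psi(w)_(j,alpha+1)  for alpha < r^j,
      Psi(w)_(j,a^j) = v_(j,a^j)          with v the last component of w.

    The closed loop is driven by an arbitrary v, so these identities are needed
    for every (w, v+) in a neighbourhood, not merely on the points that come
    from trajectories.  This is where flatness enters
    (functional_independence).  A smooth relation H between w and phi_[R+1]
    becomes, through the inverse of Psi, a smooth relation between the
    phi_[0,R+1]; adding it to one component of Fu gives a second expression of
    u in terms of the flat output.  Uniqueness of the parameterization forces
    the added term to vanish identically near the equilibrium, hence H = 0.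

    Both identities, once known on a neighbourhood (Psi_cl_step, Psi_order_A),
    give the theorem: the first says that the vectors Y(k) = Psi(x, z, v)(k)
    shift along the closed loop, Y(k+1)_(j,alpha) = Y(k)_(j,alpha+1), hence
    y^j(k+a^j) = Y(k+a^j)_(j,0) = Y(k)_(j,a^j), and the second says that this
    entry is v^j(k).

    Uniqueness applies to the perturbed Fu only if that is smooth in the sense
    of iterated directional derivatives, which rests on the closure of such
    functions under composition (smooth_at_comp).  The identities at
    trajectories hold near the equilibrium because every delta^alpha(phi) is
    continuous there (cvg_phis). *)

Set Implicit Arguments.
Unset Strict Implicit.
Unset Printing Implicit Defensive.

(** * Smoothness via iterated directional derivatives *)

Section Smooth.
Variable R : realType.
Implicit Types V W : normedModType R.

(** The difference g - f vanishes near a, so it is differentiable at a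
    with differential 0. *)
Lemma near_eq_differentiable V W (f g : V -> W) (a : V) :
  (\forall q \near a, f q = g q) -> differentiable f a -> differentiable g a.
Proof.
move=> fg df.
have -> : g = f + (g - f) by apply/funext => q /=; rewrite !fctE addrC subrK.
apply: differentiableD => //.
set e := g - f.
have ea : \forall q \near a, e q = 0.
  by apply: filterS fg => q fgq; rewrite /e !fctE fgq subrr.
have e0 : e \o shift a = cst (e a) + 0 +o_ 0 id.
  apply/eqaddoP => _/posnumP[eps].
  near=> h.
  rewrite !fctE /= addr0 (nbhs_singleton ea) subr0.
  have -> : e (h + a) = 0.
    near: h; move: ea; rewrite (near_shift 0 a) /=.
    by apply: filterS => q /=; rewrite subr0.
  by rewrite normr0 mulr_ge0.
have de : 'd e a = 0 :> (V -> W).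
  rewrite (@diff_unique _ _ _ _ (\0 : {linear V -> W})) //.
  exact: cst_continuous.
apply/diff_locallyP; rewrite de; split => //; exact: cst_continuous.
Unshelve. all: by end_near. Qed.

(** Smoothness requires one neighbourhood for the iterated derivatives of all
    orders.  Bounding the order while keeping the set U fixed allows induction
    on the order; U is taken open below, so that derivatives at a point of U
    depend only on the values on U. *)
Fixpoint Ck_on V W (n : nat) (U : set V) (h : V -> W) : Prop :=
  (forall q, U q -> differentiable h q) /\
  (if n is k.+1 then forall v, Ck_on k U ('D_v h) else True).

Definition smooth_on V W (U : set V) (h : V -> W) := forall n, Ck_on n U h.

Lemma Ck_onP V W n (U : set V) (h : V -> W) :
  Ck_on n U h <-> forall s : seq V, (size s <= n)%N -> forall q, U q ->
    differentiable (foldr (fun v k => 'D_v k) h s) q.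
Proof.
elim: n h => [|n IH] h /=.
  split => [[dh _] [|//] _ q Uq|H]; first exact: dh.
  by split => // q; exact: (H [::]).
split => [[dh Dh] s|H].
  case/lastP: s => [_ q Uq|s v]; first exact: dh.
  by rewrite size_rcons foldr_rcons ltnS => sn q Uq;
    apply: (IH _).1 (Dh v) _ sn _ Uq.
split; first exact: (H [::]).
move=> v; apply/(IH _) => s sn q Uq.
by have := H (rcons s v); rewrite size_rcons foldr_rcons; apply.
Qed.

Lemma smooth_atP V W (h : V -> W) (p : V) :
  smooth_at h p <-> exists U, [/\ open U, U p & smooth_on U h].
Proof.
split=> [|[U [oU Up sU]]].
  rewrite /smooth_at /prop_near1 nbhsE => -[U [oU Up] sU].
  by exists U; split => // n; apply/Ck_onP => s _ q /sU; apply.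
have : nbhs p U by apply: open_nbhs_nbhs.
by apply: filterS => q Uq s; have /Ck_onP := sU (size s); apply.
Qed.

Lemma Ck_on_diff V W n (U : set V) (h : V -> W) q :
  Ck_on n U h -> U q -> differentiable h q.
Proof. by case: n => [|n] [dh _]; exact: dh. Qed.

Lemma Ck_on_pred V W n (U : set V) (h : V -> W) : Ck_on n.+1 U h -> Ck_on n U h.
Proof.
move=> /Ck_onP H; apply/Ck_onP => s sn; apply: H; exact: leqW.
Qed.

Lemma Ck_on_subset V W n (U U' : set V) (h : V -> W) :
  U `<=` U' -> Ck_on n U' h -> Ck_on n U h.
Proof. by move=> sub /Ck_onP H; apply/Ck_onP => s sn q /sub; exact: H. Qed.

Lemma Ck_on_ext V W n (U : set V) (h h' : V -> W) :
  open U -> (forall q, U q -> h q = h' q) -> Ck_on n U h -> Ck_on n U h'.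
Proof.
move=> oU; elim: n h h' => [|n IH] h h' hh' [dh Dh].
  split => // q Uq; apply: near_eq_differentiable (dh _ Uq).
  by apply: filterS hh' _; exact: open_nbhs_nbhs.
have near_eq q : U q -> \forall x \near q, h x = h' x.
  by move=> Uq; apply: filterS hh' _; exact: open_nbhs_nbhs.
split => [q Uq|v]; first exact: near_eq_differentiable (near_eq _ Uq) (dh _ Uq).
apply: IH (Dh v) => q Uq; exact/near_eq_derive/near_eq.
Qed.

Lemma Ck_on_cst V W n (U : set V) (a : W) : Ck_on n U (cst a : V -> W).
Proof.
elim: n a => [|n IH] a; split => //;
  try by move=> q _; exact: differentiable_cst.
move=> v; have -> : 'D_v (cst a : V -> W) = cst 0.
  by apply/funext => q; rewrite derive_cst.
exact: IH.
Qed.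

Lemma Ck_on_add V W n (U : set V) (h k : V -> W) : open U ->
  Ck_on n U h -> Ck_on n U k -> Ck_on n U (fun q => h q + k q).
Proof.
move=> oU; elim: n h k => [|n IH] h k hn kn; (split => [q Uq|//]);
  try by apply: differentiableD;
    [exact: Ck_on_diff hn Uq|exact: Ck_on_diff kn Uq].
move=> v.
apply: (Ck_on_ext (h := fun q => 'D_v h q + 'D_v k q)) => //.
  move=> q Uq; rewrite -[RHS]/('D_v (h + k) q).
  by rewrite deriveD //; apply: diff_derivable;
    [exact: Ck_on_diff hn Uq|exact: Ck_on_diff kn Uq].
by apply: IH; [exact: hn.2|exact: kn.2].
Qed.

Lemma Ck_on_sum V W n (U : set V) (I : finType) (h : I -> V -> W) : open U ->
  (forall i, Ck_on n U (h i)) -> Ck_on n U (fun q => \sum_i h i q).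
Proof.
move=> oU hn; elim: (index_enum I) => [|i s IH].
  by apply: (Ck_on_ext oU _ (Ck_on_cst n U 0)) => q _; rewrite big_nil.
by apply: (Ck_on_ext oU _ (Ck_on_add oU (hn i) IH)) => q _; rewrite big_cons.
Qed.

Lemma Ck_on_mul V n (U : set V) (h k : V -> R^o) : open U ->
  Ck_on n U h -> Ck_on n U k -> Ck_on n U (fun q => h q * k q : R^o).
Proof.
move=> oU; elim: n h k => [|n IH] h k hn kn; (split => [q Uq|//]);
  try by apply: differentiableM;
    [exact: Ck_on_diff hn Uq|exact: Ck_on_diff kn Uq].
move=> v.
apply: (Ck_on_ext (h := fun q => h q * 'D_v k q + k q * 'D_v h q : R^o)) => //.
  move=> q Uq; rewrite -[RHS]/('D_v (h * k) q).
  by rewrite deriveM //; apply: diff_derivable;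
    [exact: Ck_on_diff hn Uq|exact: Ck_on_diff kn Uq].
by apply: Ck_on_add => //; apply: IH;
  [exact: Ck_on_pred|exact: kn.2|exact: Ck_on_pred|exact: hn.2].
Qed.

Lemma Ck_on_linear V V' W n (U : set V) (h : V -> V') (l : V' -> W) :
  linear l -> continuous l -> open U -> Ck_on n U h -> Ck_on n U (l \o h).
Proof.
move=> lin cl oU.
pose L : {linear V' -> W} := HB.pack l (GRing.isLinear.Build _ _ _ _ l lin).
have dl q : differentiable l q by exact: (linear_differentiable (f := L)).
elim: n h => [|n IH] h hn; (split => [q Uq|//]);
  try by apply: differentiable_comp; [exact: Ck_on_diff hn Uq|].
move=> v; apply: (Ck_on_ext (h := l \o 'D_v h)) => //.
  move=> q Uq; have dh := Ck_on_diff hn Uq.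
  have dc := differentiable_comp dh (dl (h q)).
  rewrite (deriveE _ dc) (diff_comp dh (dl (h q))) /= (deriveE _ dh).
  by rewrite (diff_lin (f := L) _ cl).
by apply: IH; exact: hn.2.
Qed.

Lemma Ck_on_pair V W W' n (U : set V) (h : V -> W) (k : V -> W') :
  open U -> Ck_on n U h -> Ck_on n U k -> Ck_on n U (fun q => (h q, k q)).
Proof.
move=> oU; elim: n h k => [|n IH] h k hn kn; (split => [q Uq|//]);
  try by apply: differentiable_pair;
    [exact: Ck_on_diff hn Uq|exact: Ck_on_diff kn Uq].
move=> v; apply: (Ck_on_ext (h := fun q => ('D_v h q, 'D_v k q))) => //.
  move=> q Uq; have dh := Ck_on_diff hn Uq; have dk := Ck_on_diff kn Uq.
  have dp := differentiable_pair dh dk.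
  by rewrite (deriveE _ dp) (diff_pair dh dk) /= (deriveE _ dh) (deriveE _ dk).
by apply: IH; [exact: hn.2|exact: kn.2].
Qed.

(** A finite-dimensional space presented by vectors e and continuous coordinate
    functionals l.  It is what lets the chain rule be written as a finite sum
    of products of directional derivatives. *)
Definition has_coordinates V := exists (I : finType) (e : I -> V)
    (l : I -> V -> R^o),
  (forall i, linear (l i) /\ continuous (l i)) /\
  forall v, v = \sum_i l i v *: e i.

Lemma rV_has_coordinates n : has_coordinates 'rV[R]_n.
Proof.
exists 'I_n, (fun i => delta_mx 0 i),
  (fun i (v : 'rV[R]_n) => v 0 i : R^o).
split=> [i|v]; last exact: row_sum_delta.
by split; [move=> a u v; rewrite !mxE|exact: coord_continuous].
Qed.

Lemma regular_has_coordinates : has_coordinates R^o.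
Proof.
exists unit, (fun=> 1), (fun=> id); split=> [i|v]; first by split => // x.
by rewrite (big_pred1 tt) => [|[]//]; rewrite /GRing.scale /= mulr1.
Qed.

Lemma prod_has_coordinates V W :
  has_coordinates V -> has_coordinates W -> has_coordinates (V * W)%type.
Proof.
move=> [I [e [l [cl le]]]] [I' [e' [l' [cl' le']]]].
exists (I + I')%type,
  (fun k => match k with inl i => (e i, 0) | inr i => (0, e' i) end),
  (fun k v => match k with inl i => l i v.1 | inr i => l' i v.2 end).
split=> [[i|i]|v].
- split; first by move=> a u v; rewrite (cl i).1.
  move=> q; apply: (continuous_comp (f := fst) (g := l i)).
    exact: cvg_fst.
  exact: (cl i).2.
- split; first by move=> a u v; rewrite (cl' i).1.
  move=> q; apply: (continuous_comp (f := snd) (g := l' i)).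
    exact: cvg_snd.
  exact: (cl' i).2.
rewrite big_sumType /=; case: v => a b /=.
have inl0 : \sum_i l i a *: (e i, 0 : W) = (a, 0).
  rewrite [in RHS](le a).
  rewrite (big_morph (fun u : V => (u, 0 : W)) (id1 := 0) (op1 := +%R)) //.
    by apply: eq_bigr => i _; congr (_, _); rewrite scaler0.
  by move=> u u'; congr (_, _); rewrite addr0.
have inr0 : \sum_i l' i b *: (0 : V, e' i) = (0, b).
  rewrite [in RHS](le' b).
  rewrite (big_morph (fun u : W => (0 : V, u)) (id1 := 0) (op1 := +%R)) //.
    by apply: eq_bigr => i _; congr (_, _); rewrite scaler0.
  by move=> u u'; congr (_, _); rewrite addr0.
by rewrite inl0 inr0; congr (_, _); rewrite ?addr0 ?add0r.
Qed.

(** By the chain rule, D_v(h o k) is the sum over i of the i-th coordinate of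
    D_v k times (D_(e i) h) o k: a sum of products of functions to which the
    induction hypothesis applies.  A vector-valued h is reduced to its
    coordinates. *)
Lemma Ck_on_comp V V' W n (U : set V) (U' : set V')
    (k : V -> V') (h : V' -> W) :
  has_coordinates V' -> has_coordinates W ->
  open U -> open U' -> (forall q, U q -> U' (k q)) ->
  Ck_on n U k -> Ck_on n U' h -> Ck_on n U (h \o k).
Proof.
move=> [I [e [l [cl le]]]] [I' [e' [l' [cl' le']]]] oU oU' kU.
have scalar (h0 : V' -> R^o) : Ck_on n U k -> Ck_on n U' h0 ->
  Ck_on n U (h0 \o k).
  elim: n h0 => [|n IH] h0 kn hn; (split => [q Uq|//]);
    try by apply: differentiable_comp;
      [exact: Ck_on_diff kn Uq|exact: Ck_on_diff hn (kU _ Uq)].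
  move=> v.
  apply: (Ck_on_ext (h := fun q =>
    \sum_i (l i ('D_v k q) * ('D_(e i) h0 \o k) q : R^o))) => //.
    move=> q Uq.
    have dk := Ck_on_diff kn Uq; have dh := Ck_on_diff hn (kU _ Uq).
    have dc := differentiable_comp dk dh.
    rewrite (deriveE _ dc) (diff_comp dk dh) (deriveE _ dk) /=.
    rewrite [in RHS](le ('d k q v)) linear_sum; apply: eq_bigr => i _.
    by rewrite linearZ /= (deriveE _ dh).
  apply: Ck_on_sum => // i; apply: Ck_on_mul => //.
    by apply: Ck_on_linear => //;
      [exact: (cl i).1|exact: (cl i).2|exact: kn.2].
  by apply: IH; [exact: Ck_on_pred|exact: hn.2].
move=> kn hn.
apply: (Ck_on_ext (h := fun q => \sum_i ((l' i \o h) \o k) q *: e' i)) => //.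
apply: Ck_on_sum => [//|i].
apply: (Ck_on_linear (l := fun t : R^o => t *: e' i)
  (h := (l' i \o h) \o k)) => //.
- by move=> a s t; rewrite scalerDl scalerA.
- exact: scalel_continuous.
by apply: scalar => //; apply: Ck_on_linear => //;
  [exact: (cl' i).1|exact: (cl' i).2].
Qed.

End Smooth.

Section SmoothAt.
Variable R : realType.
Implicit Types U V W : normedModType R.

Lemma smooth_at_continuous V W (h : V -> W) p :
  smooth_at h p -> h q @[q --> p] --> h p.
Proof.
move=> /nbhs_singleton /(_ [::]) /= dh; exact: differentiable_continuous.
Qed.

Lemma open_Ck_on_preimage V W (S : set V) (T : set W) (k : V -> W) :
  open S -> open T -> Ck_on 0 S k -> open (S `&` k @^-1` T).
Proof.
move=> oS oT sk; rewrite openE => q [Sq Tq].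
apply: filterI; first exact: open_nbhs_nbhs.
have ck := differentiable_continuous (Ck_on_diff sk Sq).
by apply: ck; exact: open_nbhs_nbhs.
Qed.

Lemma smooth_at_comp U V W (k : U -> V) (h : V -> W) p :
  has_coordinates V -> has_coordinates W ->
  smooth_at k p -> smooth_at h (k p) -> smooth_at (h \o k) p.
Proof.
move=> cV cW /smooth_atP[S [oS Sp sk]] /smooth_atP[T [oT Tp sh]].
have oST := open_Ck_on_preimage oS oT (sk 0%N).
apply/smooth_atP; exists (S `&` k @^-1` T); split => // n.
apply: (Ck_on_comp cV cW oST oT _ _ (sh n)) => [q []//|].
by apply: Ck_on_subset (sk n) => q [].
Qed.

Lemma smooth_at_add V W (h k : V -> W) p :
  smooth_at h p -> smooth_at k p -> smooth_at (fun q => h q + k q) p.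
Proof.
move=> /smooth_atP[S [oS Sp sh]] /smooth_atP[T [oT Tp sk]].
apply/smooth_atP; exists (S `&` T); split => [||n]; [exact: openI|by []|].
by apply: Ck_on_add; [exact: openI|exact: Ck_on_subset (sh n)|
  exact: Ck_on_subset (sk n)].
Qed.

Lemma smooth_at_pair V W W' (h : V -> W) (k : V -> W') p :
  smooth_at h p -> smooth_at k p -> smooth_at (fun q => (h q, k q)) p.
Proof.
move=> /smooth_atP[S [oS Sp sh]] /smooth_atP[T [oT Tp sk]].
apply/smooth_atP; exists (S `&` T); split => [||n]; [exact: openI|by []|].
by apply: Ck_on_pair; [exact: openI|exact: Ck_on_subset (sh n)|
  exact: Ck_on_subset (sk n)].
Qed.

Lemma smooth_at_linear_comp U V W (k : U -> V) (l : V -> W) p :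
  linear l -> continuous l -> smooth_at k p -> smooth_at (l \o k) p.
Proof.
move=> lin cl /smooth_atP[S [oS Sp sk]]; apply/smooth_atP.
by exists S; split => // n; exact: Ck_on_linear.
Qed.

Lemma smooth_at_id V (p : V) : smooth_at id p.
Proof.
apply/smooth_atP; exists setT; split => //; first exact: openT.
case=> [|n]; split => // v.
by have -> : 'D_v id = cst v :> (V -> V);
  [apply/funext => q; exact: derive_id|exact: Ck_on_cst].
Qed.

Lemma smooth_at_linear V W (l : V -> W) p :
  linear l -> continuous l -> smooth_at l p.
Proof.
by move=> lin cl; exact: (smooth_at_linear_comp lin cl (smooth_at_id p)).
Qed.

Lemma smooth_at_fst V W (p : V * W) : smooth_at fst p.
Proof. by apply: smooth_at_linear => // q; exact: cvg_fst. Qed.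

Lemma smooth_at_snd V W (p : V * W) : smooth_at snd p.
Proof. by apply: smooth_at_linear => // q; exact: cvg_snd. Qed.

Lemma smooth_at_scale V W (h : V -> R^o) (e : W) p :
  smooth_at h p -> smooth_at (fun q => h q *: e) p.
Proof.
apply: (smooth_at_linear_comp (l := fun t : R^o => t *: e)).
  by move=> a s t; rewrite scalerDl scalerA.
exact: scalel_continuous.
Qed.

Lemma smooth_at_sub V (h k : V -> R^o) p :
  smooth_at h p -> smooth_at k p -> smooth_at (fun q => h q - k q : R^o) p.
Proof.
move=> sh sk; apply: smooth_at_add => //.
apply: (smooth_at_linear_comp (l := fun t : R^o => - t : R^o)) => //.
  by move=> a s t; rewrite opprD scalerN.
exact: opp_continuous.
Qed.

Lemma smooth_at_rV V n (h : V -> 'rV[R]_n) p :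
  (forall i, smooth_at (fun q => h q 0 i : R^o) p) -> smooth_at h p.
Proof.
move=> sh.
have -> : h = (fun q => \sum_i h q 0 i *: delta_mx 0 i).
  by apply/funext => q; exact: row_sum_delta.
elim: (index_enum 'I_n) => [|i s IH].
  have -> : (fun q => \sum_(i <- [::]) h q 0 i *: delta_mx 0 i) =
      cst (0 : 'rV[R]_n).
    by apply/funext => q; rewrite big_nil.
  by apply/smooth_atP; exists setT; split => // [|k];
    [exact: openT|exact: Ck_on_cst].
under eq_fun do rewrite big_cons.
by apply: smooth_at_add => //; exact: smooth_at_scale.
Qed.

Lemma cvg_mx T (F : set_system T) n m
    (M : T -> 'M[R]_(m, n)) (l : 'M[R]_(m, n)) : Filter F ->
  (forall i j, (M t i j : R) @[t --> F] --> (l i j : R)) -> M @ F --> l.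
Proof.
move=> FF cM; apply/cvg_ballP => e e0.
have H : \forall t \near F, forall i j, ball (l i j) e (M t i j).
  apply: filter_forall => i; apply: filter_forall => j.
  by have /cvg_ballP := cM i j; apply.
by apply: filterS H => t Ht; split.
Qed.

Lemma cvg_pair_normed T (F : set_system T) V W
    (h : T -> V) (k : T -> W) (a : V) (b : W) :
  Filter F -> h @ F --> a -> k @ F --> b -> (h t, k t) @[t --> F] --> (a, b).
Proof. by move=> FF ha kb; exact: (cvg_pair (G := nbhs a) (H := nbhs b)). Qed.

End SmoothAt.

(** * Vectors over multi-index ranges *)

Section MultiIndex.
Variables (R : realType) (m : nat).
Implicit Types A B : 'I_m -> nat.

Lemma midx_inj A B (s t : midx A B) :
  mcomp s = mcomp t -> mord s = mord t -> s = t.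
Proof.
rewrite /mord /mcomp; case: s t => [j a] [j' a'] /= jj'.
move: a'; rewrite -jj' => a'.
by move=> /addnI/val_inj ->.
Qed.

Lemma mord_bounds A B (s : midx A B) : (A (mcomp s) <= mord s < B (mcomp s))%N.
Proof.
rewrite /mord /mcomp; case: s => [j a] /=; rewrite leq_addr /=.
by have := ltn_ord a; rewrite ltn_subRL.
Qed.

Lemma mget_enum A B (y : mvec R A B) k :
  mget y (mcomp (enum_val k : midx A B)) (mord (enum_val k : midx A B)) = y 0 k.
Proof.
rewrite /mget (big_pred1 k) // => i /=.
apply/andP/eqP => [[/eqP e1 /eqP e2]|-> //].
by apply: enum_val_inj; exact: midx_inj.
Qed.

Lemma mget_mpack A B (y : 'I_m -> nat -> R) j alpha :
  (A j <= alpha < B j)%N -> mget (mpack A B y) j alpha = y j alpha.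
Proof.
move=> /andP[Aa aB].
have lt : (alpha - A j < B j - A j)%N
  by rewrite ltn_sub2r // (leq_ltn_trans Aa).
pose s : midx A B := Tagged (fun j => 'I_(B j - A j)) (Ordinal lt).
have sj : mcomp s = j by [].
have sa : mord s = alpha by rewrite /mord /= subnKC.
rewrite -{1}sj -{1}sa -(enum_rankK s) mget_enum mxE enum_rankK.
by rewrite sj sa.
Qed.

Lemma eq_mpack A B (y y' : 'I_m -> nat -> R) :
  (forall j alpha, (A j <= alpha < B j)%N -> y j alpha = y' j alpha) ->
  mpack A B y = mpack A B y'.
Proof.
by move=> eqy; apply/rowP => k; rewrite !mxE; apply: eqy; exact: mord_bounds.
Qed.

Lemma mpack_mget A B (y : mvec R A B) : mpack A B (mget y) = y.
Proof. by apply/rowP => k; rewrite mxE mget_enum. Qed.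

Lemma mget_linear A B j alpha :
  linear (fun y : mvec R A B => mget y j alpha : R^o).
Proof.
move=> a y y'; rewrite /mget scaler_sumr -big_split /=.
by apply: eq_bigr => k _; rewrite !mxE.
Qed.

Lemma mget_continuous A B j alpha :
  continuous (fun y : mvec R A B => mget y j alpha : R^o).
Proof.
move=> y; apply: (cvg_big (op := +%R) (@add_continuous _) (F := nbhs y)) => k _.
exact: coord_continuous.
Qed.

Lemma smooth_at_mget (V : normedModType R) A B (h : V -> mvec R A B) j alpha p :
  smooth_at h p -> smooth_at (fun q => mget (h q) j alpha : R^o) p.
Proof.
apply: (smooth_at_linear_comp
  (l := fun y : mvec R A B => mget y j alpha : R^o)).
  exact: mget_linear.
exact: mget_continuous.
Qed.

Lemma smooth_at_mpack (V : normedModType R) A B (h : V -> 'I_m -> nat -> R) p :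
  (forall j alpha, smooth_at (fun q => h q j alpha : R^o) p) ->
  smooth_at (fun q => mpack A B (h q)) p.
Proof.
move=> sh; apply: smooth_at_rV => k.
by under eq_fun do rewrite mxE.
Qed.

Lemma smooth_at_mrestr (V : normedModType R) A B (A' B' : 'I_m -> nat)
    (h : V -> mvec R A B) q :
  smooth_at h q -> smooth_at (fun q => Defs.mrestr A' B' (h q)) q.
Proof.
by move=> sh; apply: smooth_at_mpack => j alpha; exact: smooth_at_mget.
Qed.

End MultiIndex.

(** * Trajectories near the equilibrium *)

Section Trajectories.
Variables (R : realType) (n m : nat).
Implicit Types p : traj R n m.

(** The property tnear as a filter, so that convergence along trajectories
    close to p0 can be expressed and combined. *)
Definition tnbhs p0 : set_system (traj R n m) := tnear p0.

Lemma tnbhs_filter p0 : Filter (tnbhs p0).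
Proof.
split=> [|P Q [d [d0 dP]] [e [e0 eQ]]|P Q PQ [d [d0 dP]]].
- by exists 1; split.
- exists (Order.min d e); split; first by rewrite lt_min d0.
  move=> p pd; split; [apply: dP|apply: eQ] => c; apply: lt_le_trans (pd c) _;
    by rewrite ge_min lexx ?orbT.
- by exists d; split => // p /dP/PQ.
Qed.
#[local] Existing Instance tnbhs_filter.

Lemma tnear_singleton p0 (P : traj R n m -> Prop) : tnear p0 P -> P p0.
Proof. by move=> [e [e0]]; apply => c; rewrite subrr normr0. Qed.

Lemma cvg_traj_coord p0 c : (p c : R) @[p --> tnbhs p0] --> (p0 c : R).
Proof.
apply/cvgrPdist_lt => e e0; exists e; split => // p /(_ c).
by rewrite distrC.
Qed.

Lemma cvg_window q1 q2 p0 :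
  window q1 q2 p @[p --> tnbhs p0] --> window q1 q2 p0.
Proof.
have cmx a b (C : 'I_a -> 'I_b -> Defs.coord n m) :
  (\matrix_(i, j) p (C i j)) @[p --> tnbhs p0] --> \matrix_(i, j) p0 (C i j).
  apply: cvg_mx => i j; (under eq_fun do rewrite mxE); rewrite mxE;
    exact: cvg_traj_coord.
by apply: cvg_pair_normed; first apply: cvg_pair_normed; exact: cmx.
Qed.

Lemma cvg_x_of p0 : x_of p @[p --> tnbhs p0] --> x_of p0.
Proof.
apply: cvg_mx => i j; (under eq_fun do rewrite mxE); rewrite mxE;
  exact: cvg_traj_coord.
Qed.

Lemma cvg_u_of p0 : u_of p @[p --> tnbhs p0] --> u_of p0.
Proof.
apply: cvg_mx => i j; (under eq_fun do rewrite mxE); rewrite mxE;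
  exact: cvg_traj_coord.
Qed.

Variables (f : 'rV[R]_n * 'rV[R]_m -> 'rV[R]_n)
          (g : 'rV[R]_n * 'rV[R]_m -> 'rV[R]_m).
Variables (x0 : 'rV[R]_n) (u0 : 'rV[R]_m).
Hypothesis sys : is_system f g x0 u0.
Notation p0 := (equilibrium_traj g x0 u0).

Lemma x_of_equilibrium : x_of p0 = x0.
Proof. by apply/rowP => i; rewrite mxE. Qed.

Lemma u_of_equilibrium : u_of p0 = u0.
Proof. by apply/rowP => i; rewrite mxE. Qed.

Lemma traj_shift_equilibrium : traj_shift f g p0 = p0.
Proof.
case: sys => _ fx0 _ _; apply/funext => -[[|b] j|i|a j] //=.
  by rewrite x_of_equilibrium u_of_equilibrium.
by rewrite x_of_equilibrium u_of_equilibrium fx0.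
Qed.

(** The equilibrium trajectory is fixed by the shift, and the only entries of
    the shifted trajectory that are not entries of the trajectory itself are
    the values of f and g, which are continuous at the equilibrium. *)
Lemma tnear_traj_shift (P : traj R n m -> Prop) :
  tnear p0 P -> tnear p0 (P \o traj_shift f g).
Proof.
case: sys => _ fx0 _ [sfg _]; move=> [e [e0 eP]].
have cxu : (x_of p, u_of p) @[p --> tnbhs p0] --> (x0, u0).
  apply: cvg_pair_normed.
    by rewrite -[X in _ --> X]x_of_equilibrium; exact: cvg_x_of.
  by rewrite -[X in _ --> X]u_of_equilibrium; exact: cvg_u_of.
have cfg := cvg_comp _ _ cxu (smooth_at_continuous sfg).
rewrite /= fx0 in cfg.
have /cvg_ballP/(_ e e0) [d [d0 dfg]] := cfg.
exists (Order.min d e); split; first by rewrite lt_min d0.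
move=> p pd; apply: eP => c.
have pd' c' : `|p c' - p0 c'| < d.
  by apply: lt_le_trans (pd c') _; rewrite ge_min lexx.
have pe c' : `|p c' - p0 c'| < e.
  by apply: lt_le_trans (pd c') _; rewrite ge_min lexx orbT.
have [[_ fe] [_ ge]] := dfg p pd'.
case: c => [[|b] j|i|a j] /=; try exact: (pe (Zeta b j));
  try exact: (pe (U a.+1 j)).
- by rewrite distrC; exact: ge.
- by rewrite distrC; exact: fe.
Qed.

Lemma cvg_traj_shift T (h : traj R n m -> T) (F : set_system T) :
  h @ tnbhs p0 --> F -> (h \o traj_shift f g) @ tnbhs p0 --> F.
Proof. by move=> hF S /hF; exact: tnear_traj_shift. Qed.

Variables (q1 q2 : nat)
  (phi : 'M[R]_(q1, m) * 'rV[R]_n * 'M[R]_(q2.+1, m) -> 'rV[R]_m).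
Hypothesis sphi : smooth_at phi (window q1 q2 p0).
Notation phis := (phis f g phi).
Notation phivec := (phivec f g phi).

Lemma phisS j alpha p : phis j alpha.+1 p = phis j alpha (traj_shift f g p).
Proof.
rewrite /Defs.phis iterSr; elim: alpha p => //= a IH p.
by rewrite /delta /= IH.
Qed.

Lemma cvg_phis j alpha :
  (phis j alpha p : R) @[p --> tnbhs p0] --> (phis j alpha p0 : R).
Proof.
elim: alpha => [|alpha IH].
  apply: (cvg_comp _ (fun y : 'rV[R]_m => y 0 j)); last exact: coord_continuous.
  apply: (cvg_comp (window q1 q2) phi); first exact: cvg_window.
  exact: smooth_at_continuous.
have -> : phis j alpha.+1 = phis j alpha \o traj_shift f g.
  by apply/funext => p; rewrite phisS.
by rewrite /= traj_shift_equilibrium; exact: cvg_traj_shift.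
Qed.

Lemma mget_phivec A B p j alpha : (A j <= alpha < B j)%N ->
  mget (phivec A B p) j alpha = phis j alpha p.
Proof. exact: mget_mpack. Qed.

Lemma mrestr_phivec A B A' B' p :
  (forall j, (A j <= A' j)%N) -> (forall j, (B' j <= B j)%N) ->
  Defs.mrestr A' B' (phivec A B p) = phivec A' B' p.
Proof.
move=> AA BB; apply: eq_mpack => j alpha /andP[ha hb].
by rewrite mget_phivec // (leq_trans (AA j) ha) (leq_trans hb (BB j)).
Qed.

Lemma cvg_phivec A B : phivec A B p @[p --> tnbhs p0] --> phivec A B p0.
Proof.
apply: cvg_mx => i j; (under eq_fun do rewrite mxE); rewrite mxE;
  exact: cvg_phis.
Qed.

Variables (r A : 'I_m -> nat) (nc : nat) (c : 'I_nc -> midx mix0 A).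
Notation cl_point := (cl_point f g phi r c).

Lemma cvg_cl_point : cl_point p @[p --> tnbhs p0] --> cl_point p0.
Proof.
apply: cvg_pair_normed; last exact: cvg_phivec.
apply: cvg_pair_normed; first exact: cvg_x_of.
apply: cvg_mx => i j; (under eq_fun do rewrite mxE); rewrite mxE;
  exact: cvg_phis.
Qed.

(** phi_[R+1], the functions that enter the jet phi_[A,R] when it is
    shifted. *)
Definition next_phi p : 'rV[R]_m := \row_j phis j (r j).+1 p.

Variables (Fx : mvec R mix0 r -> 'rV[R]_n)
          (Fu : mvec R mix0 (msucc r) -> 'rV[R]_m).
Hypothesis flat : flat_output f g phi p0 Fx Fu.
Variable Psi : cspace R n A r nc -> mvec R mix0 (msucc r).
Hypothesis PsiP : is_Psi f g phi p0 c Psi.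

(** The functions x, phi_c, phi_[A,R+1] satisfy no smooth relation near the
    equilibrium.  Otherwise, adding the relation to one component of Fu would
    give another expression of u by y_[0,R+1], against the uniqueness of the
    parameterization.  The index j0 is the component that gets perturbed. *)
Lemma functional_independence
    (H : cspace R n A r nc * 'rV[R]_m -> R^o) (j0 : 'I_m) :
  smooth_at H (cl_point p0, next_phi p0) ->
  tnear p0 (fun p => H (cl_point p, next_phi p) = 0) ->
  \forall s \near (cl_point p0, next_phi p0), H s = 0.
Proof.
case: flat => _ [sFx eFx] [sFu eFu] uniq.
case: PsiP => -[sPsi [K [sK KPsi _]]] ePsi sH eH.
pose SS := msucc (msucc r).
have rSS j : (r j <= SS j)%N by rewrite /SS /msucc leqW.
have rSS1 j : (msucc r j <= SS j)%N by rewrite /SS /msucc.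
(* Both directions of the correspondence y_[0,R+1] <-> (w, phi_[R+1]):
   pre below, and post, its local right inverse. *)
pose pre (y : mvec R mix0 SS) : cspace R n A r nc * 'rV[R]_m :=
  (K (Defs.mrestr mix0 (msucc r) y), \row_j mget y j (r j).+1).
have prephi : tnear p0 (fun p =>
  pre (phivec mix0 SS p) = (cl_point p, next_phi p)).
  have KPsi' := cvg_cl_point KPsi.
  apply: filterS2 ePsi KPsi' => p e1 e2; rewrite /pre; congr (_, _).
    by rewrite mrestr_phivec // e1.
  by apply/rowP => j; rewrite !mxE mget_phivec // /SS /msucc ltnSn.
have pre0 := tnear_singleton prephi.
have Psi0 := tnear_singleton ePsi.
set Q0 := phivec mix0 SS p0.
have restr0 : Defs.mrestr mix0 (msucc r) Q0 = phivec mix0 (msucc r) p0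
  by exact: mrestr_phivec.
have srestr B : smooth_at (fun y => Defs.mrestr mix0 B y) Q0.
  by apply: smooth_at_mrestr; exact: smooth_at_id.
have spre : smooth_at pre Q0.
  apply: smooth_at_pair.
    apply: (smooth_at_comp (k := Defs.mrestr mix0 (msucc r)) (h := K)).
    - exact: rV_has_coordinates.
    - by do 2?apply: prod_has_coordinates; exact: rV_has_coordinates.
    - exact: srestr.
    - by rewrite restr0 Psi0.
  apply: smooth_at_rV => j; under eq_fun do rewrite mxE.
  by apply: smooth_at_mget; exact: smooth_at_id.
pose Gx (y : mvec R mix0 SS) := Fx (Defs.mrestr mix0 r y).
pose Gu (y : mvec R mix0 SS) :=
  Fu (Defs.mrestr mix0 (msucc r) y) + H (pre y) *: delta_mx 0 j0.
have eGx : expresses f g phi p0 (@x_of R n m) Gx.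
  split.
    apply: (smooth_at_comp (k := Defs.mrestr mix0 r) (h := Fx));
      [exact: rV_has_coordinates|exact: rV_has_coordinates|exact: srestr|].
    by rewrite mrestr_phivec.
  by apply: filterS eFx => p; rewrite /Gx mrestr_phivec.
have eGu : expresses f g phi p0 (@u_of R n m) Gu.
  split.
    apply: smooth_at_add.
      apply: (smooth_at_comp (k := Defs.mrestr mix0 (msucc r)) (h := Fu));
        [exact: rV_has_coordinates|exact: rV_has_coordinates|exact: srestr|].
      by rewrite mrestr_phivec.
    apply: smooth_at_scale; apply: (smooth_at_comp (k := pre) (h := H)) => //.
    - by do 3?apply: prod_has_coordinates; exact: rV_has_coordinates.
    - exact: regular_has_coordinates.
    - by rewrite pre0.
  apply: (@filterS3 _ (tnbhs p0) _ _ _ _ _ _ eFu eH prephi) => p eu h0 pre_p.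
  by rewrite eu /Gu pre_p h0 scale0r addr0 mrestr_phivec.
have [_ nearG] := uniq _ _ _ eGx eGu.
have nearH : \forall y \near Q0, H (pre y) = 0.
  apply: filterS nearG => y [_ /rowP /(_ j0)].
  rewrite /Gu !mxE !eqxx /= mulr1 => e.
  by apply: (addrI (Fu (Defs.mrestr mix0 (msucc r) y) 0 j0)); rewrite addr0.
pose post (s : cspace R n A r nc * 'rV[R]_m) : mvec R mix0 SS :=
  mpack mix0 SS (fun j alpha =>
    if (alpha <= r j)%N then mget (Psi s.1) j alpha else s.2 0 j).
have postrestr s : Defs.mrestr mix0 (msucc r) (post s) = Psi s.1.
  rewrite -[RHS]mpack_mget; apply: eq_mpack => j alpha lt.
  have le : (alpha <= r j)%N by case/andP: lt.
  by rewrite mget_mpack ?le //= leqW.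
have prepost : \forall s \near (cl_point p0, next_phi p0), pre (post s) = s.
  have : \forall s \near (cl_point p0, next_phi p0), K (Psi s.1) = s.1.
    have sfst := smooth_at_fst (cl_point p0, next_phi p0).
    exact: (smooth_at_continuous sfst KPsi).
  apply: filterS => -[w v] /= e; rewrite /pre postrestr e; congr (_, _).
  apply/rowP => j.
  by rewrite !mxE mget_mpack /SS /msucc /mix0 /= ?ltnSn // ltnn.
have post0 : post (cl_point p0, next_phi p0) = Q0.
  apply: eq_mpack => j alpha; rewrite /= -Psi0 /SS /msucc => lt.
  case: leqP => la; first by rewrite mget_phivec.
  by rewrite mxE; congr (phis _ _ _); apply/eqP; rewrite eqn_leq la -ltnS.
have cpost : post s @[s --> (cl_point p0, next_phi p0)] --> Q0.
  rewrite -post0.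
  apply: smooth_at_continuous; apply: smooth_at_mpack => j alpha.
  case: leqP => _.
    apply: smooth_at_mget.
    apply: (smooth_at_comp (k := fst) (h := Psi)) => //.
    - by do 2?apply: prod_has_coordinates; exact: rV_has_coordinates.
    - exact: rV_has_coordinates.
    - exact: smooth_at_fst.
  apply: (smooth_at_linear_comp (k := snd)
    (l := fun v : 'rV[R]_m => v 0 j : R^o)).
  - by move=> a s t; rewrite !mxE.
  - exact: coord_continuous.
  - exact: smooth_at_snd.
have nearHpp : \forall s \near (cl_point p0, next_phi p0), H (pre (post s)) = 0.
  exact: (cpost _ nearH).
by apply: filterS2 nearHpp prepost => s; rewrite /= => + e; rewrite e.
Qed.

(** The entries phi_[R], or v_[R-A], at the top of the jet.  Those of the state
    at time k+1 are the ones that the jet at time k has to receive when it is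
    shifted. *)
Definition last_entry (w : cspace R n A r nc) : 'rV[R]_m :=
  \row_j mget w.2 j (r j).

(** The closed loop as a map on (x, z, v_[0,R-A]).  The shifted jet also needs
    v_[R-A+1], which the current state does not contain; it is the second
    argument. *)
Definition cl_step (s : cspace R n A r nc * 'rV[R]_m) : cspace R n A r nc :=
  (f (s.1.1.1, Fu (Psi s.1)), psi_c1 c Psi s.1,
   mpack A (msucc r) (fun j alpha =>
     if (alpha < r j)%N then mget s.1.2 j alpha.+1 else s.2 0 j)).

Hypothesis Ar : mle A r.

Lemma last_entry0 : last_entry (cl_point p0) = next_phi p0.
Proof.
apply/rowP => j; rewrite !mxE mget_phivec ?Ar ?leqnn //.
by rewrite phisS traj_shift_equilibrium.
Qed.

(** On the points that come from trajectories of the open-loop system, u is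
    Fu(Psi(w)), so the closed loop reproduces the forward-shift. *)
Lemma cl_step_cl_point :
  tnear p0 (fun p =>
    cl_step (cl_point p, next_phi p) = cl_point (traj_shift f g p)).
Proof.
case: flat => _ _ [_ eFu] _; case: PsiP => _ ePsi.
apply: (@filterS2 _ (tnbhs p0) _ _ _ _ _ eFu ePsi) => p eu ePsip.
rewrite /cl_step /= /psi_c1 -ePsip -eu; congr (_, _, _).
- by apply/rowP => i; rewrite !mxE.
- apply/rowP => i; rewrite !mxE -phisS mget_phivec //=.
  by case/andP: (mord_bounds (c i)) => _ lt; rewrite /msucc ltnS (leq_trans lt).
- apply: eq_mpack => j alpha /andP[Aa ar].
  case: ltnP => lt.
    by rewrite mget_phivec ?phisS // (leqW Aa) /msucc ltnS.
  have -> : alpha = r j by apply/eqP; rewrite eqn_leq lt andbT.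
  by rewrite mxE phisS.
Qed.

Lemma cspace_has_coordinates : has_coordinates (cspace R n A r nc).
Proof. by do 2?apply: prod_has_coordinates; exact: rV_has_coordinates. Qed.

Lemma smooth_at_cl_step : smooth_at cl_step (cl_point p0, next_phi p0).
Proof.
case: sys => sf _ _ _; case: flat => _ _ [sFu _] _;
  case: PsiP => -[sPsi _] ePsi.
have e0 := tnear_singleton ePsi.
have eu : Fu (Psi (cl_point p0)) = u0.
  by case: flat => _ _ [_ /tnear_singleton eFu] _;
    rewrite -e0 -eFu u_of_equilibrium.
set s0 := (cl_point p0, next_phi p0).
have s1 : smooth_at fst s0 by exact: smooth_at_fst.
have s2 : smooth_at snd s0 by exact: smooth_at_snd.
have sPsi1 : smooth_at (Psi \o fst) s0.
  apply: (smooth_at_comp (k := fst) (h := Psi)) => //;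
    [exact: cspace_has_coordinates|exact: rV_has_coordinates].
have sFuPsi : smooth_at (Fu \o (Psi \o fst)) s0.
  apply: (smooth_at_comp (k := Psi \o fst) (h := Fu)) => //;
    [exact: rV_has_coordinates|exact: rV_has_coordinates|by rewrite /= -e0].
apply: smooth_at_pair; first apply: smooth_at_pair.
- apply: (smooth_at_comp (k := fun s => (s.1.1.1, Fu (Psi s.1))) (h := f)).
  + by apply: prod_has_coordinates; exact: rV_has_coordinates.
  + exact: rV_has_coordinates.
  + apply: smooth_at_pair => //.
    apply: (smooth_at_linear_comp (k := fst)
      (l := fun w : cspace R n A r nc => w.1.1)) => //.
    by move=> w; apply: cvg_comp; exact: cvg_fst.
  + by rewrite /= eu [x_of p0]x_of_equilibrium.
- apply: smooth_at_rV => i; under eq_fun do rewrite mxE.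
  by apply: smooth_at_mget.
- apply: smooth_at_mpack => j alpha; case: (alpha < r j)%N.
    apply: smooth_at_mget.
    by apply: (smooth_at_linear_comp (k := fst)
      (l := fun w : cspace R n A r nc => w.2)) => // w; exact: cvg_snd.
  apply: (smooth_at_linear_comp (k := snd)
    (l := fun v : 'rV[R]_m => v 0 j : R^o)) => //.
  - by move=> a s t; rewrite !mxE.
  - exact: coord_continuous.
Qed.

(** On points coming from trajectories both sides are phi^j_[alpha+1];
    functional independence extends the equality to a neighbourhood. *)
Lemma Psi_cl_step : \forall s \near (cl_point p0, next_phi p0),
  forall j alpha, (alpha < r j)%N ->
    mget (Psi (cl_step s)) j alpha = mget (Psi s.1) j alpha.+1.
Proof.
case: PsiP => -[sPsi _] ePsi.
have step0 := tnear_singleton cl_step_cl_point.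
rewrite traj_shift_equilibrium in step0.
pose defect (t : midx mix0 r) (s : cspace R n A r nc * 'rV[R]_m) : R^o :=
  mget (Psi (cl_step s)) (mcomp t) (mord t) -
  mget (Psi s.1) (mcomp t) (mord t).+1.
have H : \forall s \near (cl_point p0, next_phi p0), forall t, defect t s = 0.
  apply: (filter_forall (F := nbhs (cl_point p0, next_phi p0))
    (f := fun t s => defect t s = 0)) => t.
  apply: (functional_independence (mcomp t)).
    apply: smooth_at_sub; apply: smooth_at_mget.
      apply: (smooth_at_comp (k := cl_step) (h := Psi));
        [exact: cspace_has_coordinates|exact: rV_has_coordinates|
          exact: smooth_at_cl_step|].
      by rewrite step0.
    apply: (smooth_at_comp (k := fst) (h := Psi)) => //;
      [exact: cspace_has_coordinates|exact: rV_has_coordinates|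
        exact: smooth_at_fst].
  have ePsi1 := tnear_traj_shift ePsi.
  apply: (@filterS3 _ (tnbhs p0) _ _ _ _ _ _ ePsi ePsi1 cl_step_cl_point) =>
    p /= e1 e2 e3.
  rewrite /defect.
  case/andP: (mord_bounds t) => _ lt.
  by rewrite e3 -e1 -e2 !mget_phivec ?phisS ?subrr //= leqW.
apply: filterS H => s Hs j alpha lt.
have lt' : (alpha - mix0 j < r j - mix0 j)%N by rewrite /mix0 !subn0.
have := Hs (Tagged (fun j => 'I_(r j - mix0 j)) (Ordinal lt')).
by rewrite /defect /mcomp /mord /= /mix0 add0n subn0 => /eqP;
  rewrite subr_eq0 => /eqP.
Qed.

(** On points coming from trajectories both sides are phi^j_[a^j];
    functional independence extends the equality to a neighbourhood. *)
Lemma Psi_order_A : \forall s \near (cl_point p0, next_phi p0),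
  forall j, mget (Psi s.1) j (A j) = mget s.1.2 j (A j).
Proof.
case: PsiP => -[sPsi _] ePsi.
pose defect j (s : cspace R n A r nc * 'rV[R]_m) : R^o :=
  mget (Psi s.1) j (A j) - mget s.1.2 j (A j).
have H : \forall s \near (cl_point p0, next_phi p0), forall j, defect j s = 0.
  apply: (filter_forall (F := nbhs (cl_point p0, next_phi p0))
    (f := fun j s => defect j s = 0)) => j.
  apply: (functional_independence j).
    apply: smooth_at_sub; apply: smooth_at_mget.
      apply: (smooth_at_comp (k := fst) (h := Psi)) => //;
        [exact: cspace_has_coordinates|exact: rV_has_coordinates|
          exact: smooth_at_fst].
    apply: (smooth_at_linear_comp (k := fst)
      (l := fun w : cspace R n A r nc => w.2)) => //.
      by move=> w; exact: cvg_snd.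
    exact: smooth_at_fst.
  apply: (@filterS _ (tnbhs p0) _ _ _ _ ePsi) => p /= e; rewrite /defect.
  by rewrite -e !mget_phivec ?subrr // /msucc ?leqnn ltnS Ar.
apply: filterS H => s Hs j.
by apply/eqP; rewrite -subr_eq0; apply/eqP; exact: Hs.
Qed.

Lemma cl_state_step (D : set (cspace R n A r nc)) N x z v k :
  closed_loop_traj c Psi f Fu D N x z v -> (k < N)%N ->
  cl_state A r x z v k.+1 =
    cl_step (cl_state A r x z v k, last_entry (cl_state A r x z v k.+1)).
Proof.
move=> [_ dyn] kN; have [xk zk] := dyn k kN.
rewrite {1}/cl_state xk zk /cl_step /=; congr (_, _, _).
apply: eq_mpack => j alpha /andP[Aa ar].
case: ltnP => lt.
  rewrite /= mget_mpack; last by rewrite (leqW Aa) /msucc ltnS.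
  by rewrite subSn // addnS.
have -> : alpha = r j by apply/eqP; rewrite eqn_leq lt andbT.
by rewrite mxE mget_mpack // Ar /msucc ltnSn.
Qed.

(** The identities hold for (w, v+) in a product of neighbourhoods D1 and D2.
    The domain asks for the state in D1 and for the top entries of its jet in
    D2, so that the state at time k and the top entries at time k+1 form an
    admissible pair. *)
Lemma closed_loop_io : exists D : set (cspace R n A r nc),
  nbhs (cl_point p0) D /\
  forall N x z v, closed_loop_traj c Psi f Fu D N x z v ->
    forall j k, (k + A j <= N)%N -> cl_output Psi x z v (k + A j) 0 j = v k 0 j.
Proof.
set s0 := (cl_point p0, next_phi p0).
have near_s0 := filterI Psi_cl_step Psi_order_A.
pose P (s : cspace R n A r nc * 'rV[R]_m) :=
  (forall j alpha, (alpha < r j)%N ->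
    mget (Psi (cl_step s)) j alpha = mget (Psi s.1) j alpha.+1) /\
  (forall j, mget (Psi s.1) j (A j) = mget s.1.2 j (A j)).
have [[D1 D2] /= [nD1 nD2] D12] : nbhs s0 P by exact: near_s0.
exists [set w | D1 w /\ D2 (last_entry w)]; split.
  apply: filterI => //.
  have cl : last_entry w @[w --> cl_point p0] --> last_entry (cl_point p0).
    apply: smooth_at_continuous; apply: smooth_at_rV => j;
      under eq_fun do rewrite mxE.
    by apply: smooth_at_mget; exact: smooth_at_snd.
  by apply: cl; rewrite last_entry0.
move=> N x z v traj j k kN.
have [inD _] := traj.
pose Y l alpha := mget (Psi (cl_state A r x z v l)) j alpha.
have Ystep l alpha : (l < N)%N -> (alpha < r j)%N ->
  Y l.+1 alpha = Y l alpha.+1.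
  move=> lN ar; rewrite /Y (cl_state_step traj lN).
  have [H _] := D12 (cl_state A r x z v l, last_entry (cl_state A r x z v l.+1))
    (conj (inD l (ltnW lN)).1 (inD l.+1 lN).2).
  exact: H.
have Yshift i l alpha : (l + i <= N)%N -> (alpha + i <= r j)%N ->
  Y (l + i)%N alpha = Y l (alpha + i)%N.
  elim: i alpha => [|i IH] alpha; first by rewrite !addn0.
  rewrite !addnS => lN ar.
  by rewrite Ystep // ?(leq_ltn_trans _ ar) ?leq_addr // IH ?(ltnW lN) // addSn.
have kN' : (k <= N)%N by exact: leq_trans (leq_addr _ _) kN.
rewrite mxE -/(Y _ _) Yshift ?add0n ?Ar //.
have [_ H] := D12 (cl_state A r x z v k, last_entry (cl_state A r x z v k))
  (conj (inD k kN').1 (inD k kN').2).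
by rewrite /Y H mget_mpack ?subnn ?addn0 // leqnn /msucc ltnS Ar.
Qed.

End Trajectories.

Theorem theorem4p4 (R : realType) (n m : nat)
    (f : 'rV[R]_n * 'rV[R]_m -> 'rV[R]_n)
    (g : 'rV[R]_n * 'rV[R]_m -> 'rV[R]_m)
    (x0 : 'rV[R]_n) (u0 : 'rV[R]_m)
    (q1 q2 : nat)
    (phi : 'M[R]_(q1, m) * 'rV[R]_n * 'M[R]_(q2.+1, m) -> 'rV[R]_m)
    (r : 'I_m -> nat)
    (Fx : mvec R mix0 r -> 'rV[R]_n)
    (Fu : mvec R mix0 (msucc r) -> 'rV[R]_m)
    (A : 'I_m -> nat) (nc : nat)
    (c : 'I_nc -> midx mix0 A)
    (Psi : cspace R n A r nc -> mvec R mix0 (msucc r)) :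
  let p0 := equilibrium_traj g x0 u0 in
  is_system f g x0 u0 ->
  flat_output f g phi p0 Fx Fu ->
  mle A r ->
  diff_independent p0 (indep_family f g phi (A := A) (r := r)) ->
  is_selection f g phi p0 r c ->
  is_Psi f g phi p0 c Psi ->
  exists D : set (cspace R n A r nc),
    nbhs (cl_point f g phi r c p0) D /\
    forall (N : nat) (x : nat -> 'rV[R]_n) (z : nat -> 'rV[R]_nc)
        (v : nat -> 'rV[R]_m),
      closed_loop_traj c Psi f Fu D N x z v ->
      forall (j : 'I_m) (k : nat), (k + A j <= N)%N ->
        cl_output Psi x z v (k + A j) 0 j = v k 0 j.
Proof.
move=> p0 sys flat Ar _ _ PsiP; have [sphi _ _ _] := flat.
exact: (closed_loop_io sys sphi flat PsiP Ar).
Qed.
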